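(* Let $A$ be an $\ell$-controllable complete group system with generator group $(\mathcal{U},\circ)$. Any normal filling sequence $\mathbf{f}$ of the index set $\mathbf{n}=\{0,\ldots,\ell\}\times\mathbf{Z}$ gives a normal chain of $(\mathcal{U},\circ)$: $$\mathbf{u}_{\mathbf 1}\subset L^1\subset\cdots\subset L^\tau\subset L^{\tau+1}\subset\cdots\subset(\mathcal{U},\circ),$$ in which, for each $\tau>0$, $L^\tau$ is the normal subgroup of $(\mathcal{U},\circ)$ given by the product of the lower elementary groups $\mathcal{L}_k^t$ over the maximal lower triangles $D_k^t$ formed by the first $\tau$ pairs of $\mathbf{f}$.
   Context: Let $(A^t)_{t\in\mathbf{Z}}$ be finite groups. A group system $A$ is a set of sequences $\mathbf{a}=(a^t)_{t\in\mathbf{Z}}$, $a^t\in A^t$, forming a group under componentwise operation, such that every element of $A^t$ occurs as a time-$t$ component, for each $t$. $\chi^t:A\to A^t$ is $\mathbf{a}\mapsto a^t$. $A$ is $\ell$-controllable ($\ell>0$) if for every $t\in\mathbf{Z}$ and all $\dot{\mathbf{a}},\ddot{\mathbf{a}}\in A$ there is $\mathbf{a}\in A$ agreeing with $\dot{\mathbf{a}}$ at all times $<t$ and with $\ddot{\mathbf{a}}$ at all times $\ge t+\ell$. $A$ is complete if every sequence in $\prod_t A^t$ whose restriction to each finite interval is the restriction of some element of $A$ belongs to $A$. $A^{[m,n]}$ is the set of sequences in $A$ that are the identity outside $[m,n]$. $X^t$ (resp. $Y^t$) is the normal subgroup of sequences in $A$ that are the identity at all times $<t$ (resp. $>t$).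 Basis: for $t\in\mathbf{Z}$, $0\le k\le\ell$ put $\Lambda^{[t,t+k]}=X^{t+1}(X^t\cap Y^{t+k})/X^{t+1}(X^t\cap Y^{t+k-1})$. A basis is a choice, for each $(k,t)$, of a transversal $[\Lambda^{[t,t+k]}]$ whose elements (generators $\mathbf{g}^{[t,t+k]}$) lie in $A^{[t,t+k]}$ and in which the trivial coset is represented by the identity sequence. $\mathcal{R}=\prod_{t\in\mathbf{Z}}\prod_{0\le k\le\ell}[\Lambda^{[t,t+k]}]$. The map $\alpha:\mathcal{R}\to A$ sends $\mathbf{r}=(\mathbf{g}^{[t,t+k]})_{k,t}$ to $\prod_{i=+\infty}^{-\infty}\prod_{m=0}^{\ell}\mathbf{g}^{[i,i+m]}$, i.e. the sequence with time-$t$ component $\prod_{j=0}^{\ell}\bigl(\prod_{k=j}^{\ell}\chi^t(\mathbf{g}^{[t-j,t-j+k]})\bigr)$ (factors written left to right in increasing $j$, and increasing $k$ for each $j$); $\alpha$ is a bijection. The operation $*$ on $\mathcal{R}$ is $\dot{\mathbf{r}}*\ddot{\mathbf{r}}=\alpha^{-1}(\alpha(\dot{\mathbf{r}})\alpha(\ddot{\mathbf{r}}))$. For each $(k,t)$ let $G_k^t$ be a set of labels with a fixed bijection $[\Lambda^{[t,t+k]}]\to G_k^t$, $\mathbf{g}^{[t,t+k]}\mapsto g_k^t$; the trivial label is that of the identity sequence. $\mathcal{U}=\prod_{t\in\mathbf{Z}}\prod_{0\le k\le\ell}G_k^t$, and $\beta:\mathcal{R}\to\mathcal{U}$ replaces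 each generator by its label. The operation $\circ$ on $\mathcal{U}$ is $\beta(\dot{\mathbf{r}})\circ\beta(\ddot{\mathbf{r}})=\beta(\dot{\mathbf{r}}*\ddot{\mathbf{r}})$; $(\mathcal{U},\circ)$ is the generator group, with identity $\mathbf{u}_{\mathbf 1}$ (all labels trivial). Lower triangles: $D_k^t=\{(m,s):0\le m,\ t\le s,\ s+m\le t+k\}$ (vertices $(0,t+k)$, $(0,t)$, $(k,t)$), for $0\le k\le\ell$. The lower elementary group $\mathcal{L}_k^t$ is the set of $\mathbf{u}\in\mathcal{U}$ whose labels are trivial outside $D_k^t$; it is the normal subgroup of $(\mathcal{U},\circ)$ corresponding to $A^{[t,t+k]}$ under the isomorphism $\beta\circ\alpha^{-1}:A\to\mathcal{U}$. A filling sequence $\mathbf{f}=(k',t'),(k'',t''),\ldots$ is a sequence listing every pair of $\mathbf{n}$ exactly once; $\mathbf{f}^\tau$ is its list of the first $\tau$ pairs. $\mathbf{f}$ is normal if for every $\tau>0$ the set of pairs in $\mathbf{f}^\tau$ is a union of lower triangles $D_k^t$. *)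

(* Defs.v *)
From HB Require Import structures.
From mathcomp Require Import all_boot all_order all_algebra all_fingroup.
From mathcomp Require Import boolp classical_sets functions.

Set Implicit Arguments.
Unset Strict Implicit.
Unset Printing Implicit Defensive.

Import Order.TTheory GRing.Theory Num.Theory.

Local Open Scope classical_set_scope.
Local Open Scope group_scope.

Definition gseq (A : int -> finGroupType) : Type := forall t : int, A t.

HB.instance Definition _ (A : int -> finGroupType) :=
  Choice.copy (gseq A) (forall t : int, A t).

Section GseqGroup.
Variable A : int -> finGroupType.
Implicit Types a b c : gseq A.

Definition gseq_one : gseq A := fun t => 1.
Definition gseq_mul a b : gseq A := fun t => a t * b t.
Definition gseq_inv a : gseq A := fun t => (a t)^-1.

Fact gseq_mulA : associative gseq_mul.
Proof.
by move=> a b c; apply: functional_extensionality_dep => t; apply: mulgA.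
Qed.
Fact gseq_mul1 : left_id gseq_one gseq_mul.
Proof. by move=> a; apply: functional_extensionality_dep => t; apply: mul1g. Qed.
Fact gseq_1mul : right_id gseq_one gseq_mul.
Proof. by move=> a; apply: functional_extensionality_dep => t; apply: mulg1. Qed.
Fact gseq_mulV : left_inverse gseq_one gseq_inv gseq_mul.
Proof. by move=> a; apply: functional_extensionality_dep => t; apply: mulVg. Qed.
Fact gseq_Vmul : right_inverse gseq_one gseq_inv gseq_mul.
Proof. by move=> a; apply: functional_extensionality_dep => t; apply: mulgV. Qed.

HB.instance Definition _ := isGroup.Build (gseq A)
  gseq_mulA gseq_mul1 gseq_1mul gseq_mulV gseq_Vmul.

End GseqGroup.

Record group_system (A : int -> finGroupType) := GroupSystem {
  gs_set :> gseq A -> Prop;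
  gs_one : gs_set 1;
  gs_mul : forall a b, gs_set a -> gs_set b -> gs_set (a * b);
  gs_inv : forall a, gs_set a -> gs_set a^-1;
  gs_onto : forall (t : int) (x : A t), exists2 a, gs_set a & a t = x
}.

Section GroupSystem.
Variables (A : int -> finGroupType) (S : group_system A).

Definition controllable (l : nat) : Prop :=
  (0 < l)%N /\
  forall (t : int) (a b : gseq A), S a -> S b ->
    exists c : gseq A,
      [/\ S c,
          forall s : int, (s < t)%R -> c s = a s &
          forall s : int, (t + l%:Z <= s)%R -> c s = b s].

Definition complete : Prop :=
  forall a : gseq A,
    (forall m n : int,
       exists2 b, S b & forall s : int, (m <= s)%R -> (s <= n)%R -> b s = a s) ->
    S a.

Definition Xset (t : int) : set (gseq A) :=
  [set a | S a /\ forall s : int, (s < t)%R -> a s = 1].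

Definition Yset (t : int) : set (gseq A) :=
  [set a | S a /\ forall s : int, (t < s)%R -> a s = 1].

Definition supported_in (m n : int) : set (gseq A) :=
  [set a | S a /\ forall s : int, ~~ (m <= s <= n)%R -> a s = 1].

(* X^{t+1} (X^t /\ Y^n), so that Lambda^{[t,t+k]} is the quotient of
   [XY t (t + k)] by its normal subgroup [XY t (t + k - 1)] *)
Definition XY (t n : int) : set (gseq A) :=
  [set x * y | x in Xset (t + 1)%R & y in Xset t `&` Yset n].

(* The coset of [a] contains [g] exactly when [a * g^-1] is in the normal
   subgroup [N]. *)
Definition transversal_of (P N T : set (gseq A)) : Prop :=
  T `<=` P /\ forall a, P a -> exists! g, T g /\ N (a * g^-1).

Record basis (l : nat) := Basis {
  basis_set :> 'I_l.+1 -> int -> set (gseq A);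
  basis_transversal : forall (k : 'I_l.+1) (t : int),
    transversal_of (XY t (t + k%:Z)%R) (XY t (t + k%:Z - 1)%R) (basis_set k t);
  basis_supported : forall (k : 'I_l.+1) (t : int),
    basis_set k t `<=` supported_in t (t + k%:Z)%R;
  basis_one : forall (k : 'I_l.+1) (t : int), basis_set k t 1
}.

Section Generators.
Variables (l : nat) (B : basis l).

Definition generator (k : 'I_l.+1) (t : int) : Type := {g : gseq A | B k t g}.

Definition gen_one (k : 'I_l.+1) (t : int) : generator k t :=
  exist _ 1 (basis_one B k t).

Definition Rtensor : Type := forall (k : 'I_l.+1) (t : int), generator k t.

Definition r_one : Rtensor := gen_one.

Definition alpha (r : Rtensor) : gseq A :=
  fun t : int =>
    \prod_(j < l.+1) \prod_(k < l.+1 | (j <= k)%N)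
      (sval (r k (t - j%:Z)%R)) t.

(* The library's choice-based inverse, with default value [r_one]: it is
   alpha^{-1} once alpha is known to be injective with image the system. *)
Definition alpha_inv : gseq A -> Rtensor :=
  'pinv_(fun=> r_one) [set: Rtensor] alpha.

Definition r_mul (r1 r2 : Rtensor) : Rtensor := alpha_inv (alpha r1 * alpha r2).

Section Labels.
Variables (G : 'I_l.+1 -> int -> Type).
Variable lab : forall k t, generator k t -> G k t.

Definition Utensor : Type := forall (k : 'I_l.+1) (t : int), G k t.

Definition beta (r : Rtensor) : Utensor := fun k t => lab (r k t).

Definition beta_inv : Utensor -> Rtensor :=
  'pinv_(fun=> r_one) [set: Rtensor] beta.

Definition u_mul (u v : Utensor) : Utensor := beta (r_mul (beta_inv u) (beta_inv v)).

Definition u_one : Utensor := beta r_one.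

End Labels.
End Generators.
End GroupSystem.

Section Laws.
Variables (U : Type) (op : U -> U -> U) (e : U).

Definition group_law : Prop :=
  [/\ associative op, left_id e op, right_id e op &
      forall u, exists v, op v u = e /\ op u v = e].

Definition normal_subgroup (N : set U) : Prop :=
  [/\ N e,
      forall u v, N u -> N v -> N (op u v),
      forall u v, N u -> op u v = e -> N v &
      forall g h u, N u -> op g h = e -> N (op (op g u) h)].

(* The terms are L^1, L^2, ...; [L 0] is not a term of the chain. *)
Definition normal_chain (L : nat -> set U) : Prop :=
  [/\ [set e] `<=` L 1%N,
      forall tau, (0 < tau)%N -> L tau `<=` L tau.+1 &
      forall tau, (0 < tau)%N -> normal_subgroup (L tau)].

Definition set_prod (s : seq (set U)) : set U :=
  foldr (fun P Q : set U => [set op u v | u in P & v in Q]) [set e] s.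

End Laws.

Section Filling.
Variable l : nat.

(* For [k <= l] every (m, s) in D_k^t has [m <= k <= l], so nothing of the
   triangle is lost by indexing with ['I_l.+1 * int]. *)
Definition lower_triangle (p : 'I_l.+1 * int) : set ('I_l.+1 * int) :=
  [set q : 'I_l.+1 * int | (p.2 <= q.2)%R /\ (q.2 + q.1%:Z <= p.2 + p.1%:Z)%R].

Definition filling_sequence (f : nat -> 'I_l.+1 * int) : Prop := bijective f.

Definition first_pairs (f : nat -> 'I_l.+1 * int) (tau : nat) :
  seq ('I_l.+1 * int) := mkseq f tau.

Definition normal_filling (f : nat -> 'I_l.+1 * int) : Prop :=
  filling_sequence f /\
  forall tau, (0 < tau)%N ->
    exists P : set ('I_l.+1 * int),
      [set` first_pairs f tau] = \bigcup_(p in P) lower_triangle p.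

Definition maximal_triangle (E : set ('I_l.+1 * int)) (p : 'I_l.+1 * int) : Prop :=
  lower_triangle p `<=` E /\
  forall q, lower_triangle q `<=` E -> lower_triangle p `<=` lower_triangle q ->
    lower_triangle q = lower_triangle p.

(* D_k^t determines (k, t) and contains it, so this lists every maximal lower
   triangle formed by the first [tau] pairs exactly once. *)
Definition maximal_triangles (f : nat -> 'I_l.+1 * int) (tau : nat) :
  seq ('I_l.+1 * int) :=
  [seq p <- first_pairs f tau | `[< maximal_triangle [set` first_pairs f tau] p >]].

End Filling.

Section ElementaryGroups.
Variables (A : int -> finGroupType) (S : group_system A) (l : nat) (B : basis S l).
Variables (G : 'I_l.+1 -> int -> Type) (lab : forall k t, generator B k t -> G k t).

Definition lower_elementary (p : 'I_l.+1 * int) : set (Utensor G) :=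
  [set u | forall (k : 'I_l.+1) (t : int),
     ~ lower_triangle p (k, t) -> u k t = u_one lab k t].

Definition elementary_prod (s : seq ('I_l.+1 * int)) : set (Utensor G) :=
  set_prod (u_mul lab) (u_one lab) [seq lower_elementary p | p <- s].

End ElementaryGroups.

(* Main.v *)
(* The map [alpha] is a bijection onto the group system.  Any two tensors whose
   images are congruent modulo [Yset T] have the same generators ending after
   time [T]: going down on the length [k], a generator with span [[i, i + k]] is
   read off modulo [Xset (i + 1)] times [Yset (i + k - 1)], where only strictly
   longer generators interfere.  A sequence of [Xset t] is expanded one starting
   time after another; an arbitrary sequence [a] is approximated by elements of
   [Xset T] that agree with [a] from [T + l] on, and by the previous congruence
   their expansions stabilise as [T] tends to minus infinity.

   The lower elementary groups are then the preimages of the normal subgroups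
   [supported_in].  A product of normal subgroups is the least normal subgroup
   containing them, so it does not depend on the order of the factors; and each
   triangle that is maximal among the first [tau] pairs lies in a maximal one
   among the first [tau + 1] pairs. *)
Require Import Defs.
From mathcomp Require Import all_boot all_order all_algebra all_fingroup.
From mathcomp Require Import boolp classical_sets functions.
From mathcomp Require Import zify.

Set Implicit Arguments.
Unset Strict Implicit.
Unset Printing Implicit Defensive.

Import Order.TTheory GRing.Theory Num.Theory.

Local Open Scope classical_set_scope.
Local Open Scope group_scope.

(** * Normal subgroups inside a subgroup [S], where [normal_in S S] says that [S] is one, and
    congruences modulo them *)

Record normal_in (G : groupType) (S N : set G) : Prop := NormalIn {
  normal_in_sub : N `<=` S;
  normal_in1 : N 1;
  normal_inM : forall a b, N a -> N b -> N (a * b);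
  normal_inV : forall a, N a -> N a^-1;
  normal_inJ : forall c a, S c -> N a -> N (a ^ c)
}.

Section NormalIn.
Variables (G : groupType) (S : set G).
Hypothesis S_group : normal_in S S.
Implicit Types (N P Q : set G) (a b c d : G).

Lemma normal_inI P Q : normal_in S P -> normal_in S Q -> normal_in S (P `&` Q).
Proof.
move=> [sP P1 PM PV PJ] [sQ Q1 QM QV QJ]; split=> //.
- by move=> a [/sP].
- by move=> a b [Pa Qa] [Pb Qb]; split; [apply: PM | apply: QM].
- by move=> a [Pa Qa]; split; [apply: PV | apply: QV].
- by move=> c a Sc [Pa Qa]; split; [apply: PJ | apply: QJ].
Qed.

Lemma normal_in_mul P Q : normal_in S P -> normal_in S Q ->
  normal_in S [set x * y | x in P & y in Q].
Proof.
move=> [sP P1 PM PV PJ] [sQ Q1 QM QV QJ].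
have [_ _ SM SV SJ] := S_group.
split.
- by move=> _ [x /sP Sx [y /sQ Sy <-]]; apply: SM.
- by exists 1 => //; exists 1 => //; rewrite mulg1.
- move=> _ _ [x Px [y Qy <-]] [x' Px' [y' Qy' <-]].
  exists (x * x' ^ y^-1); first by apply/PM/PJ => //; apply/SV/sQ.
  by exists (y * y'); [apply: QM | rewrite /conjg !gnorm].
- move=> _ [x Px [y Qy <-]]; exists (x^-1 ^ y); first exact/PJ/PV/Px/sQ.
  by exists y^-1; [apply: QV | rewrite /conjg !gnorm].
- move=> c _ Sc [x Px [y Qy <-]]; exists (x ^ c); first exact: PJ.
  by exists (y ^ c); [apply: QJ | rewrite /conjg !gnorm].
Qed.

Section Congruence.
Variable N : set G.
Hypothesis N_normal : normal_in S N.

Lemma congr_refl a : N (a * a^-1).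
Proof. by rewrite mulgV; apply: normal_in1 N_normal. Qed.

Lemma congr_sym a b : N (a * b^-1) -> N (b * a^-1).
Proof. by move=> /(normal_inV N_normal); rewrite invgM invgK. Qed.

Lemma congr_mem a b : N a -> N b -> N (a * b^-1).
Proof.
by move=> Na Nb; apply: (normal_inM N_normal) => //; apply: (normal_inV N_normal).
Qed.

Lemma congr_mul a b c d : S a ->
  N (a * b^-1) -> N (c * d^-1) -> N (a * c * (b * d)^-1).
Proof.
move=> Sa Nab Ncd; have -> : a * c * (b * d)^-1 = (c * d^-1) ^ a^-1 * (a * b^-1).
  by rewrite /conjg !gnorm.
apply: (normal_inM N_normal) => //; apply: (normal_inJ N_normal) => //.
exact: (normal_inV S_group).
Qed.

(** With [congr_cancell], this strips congruent outer factors from a congruence between products, so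
    that a single generator can be isolated. *)
Lemma congr_cancelr a b c d : N (a * c * (b * d)^-1) ->
  S b -> N (c * d^-1) -> N (a * b^-1).
Proof.
move=> Nabcd Sb /congr_sym Ndc.
have -> : a * b^-1 = (a * c * (b * d)^-1) * (d * c^-1) ^ b^-1.
  by rewrite /conjg !gnorm.
apply: (normal_inM N_normal) => //; apply: (normal_inJ N_normal) => //.
exact: (normal_inV S_group).
Qed.

Lemma congr_cancell a b c d : N (a * c * (b * d)^-1) ->
  S b -> N (a * b^-1) -> N (c * d^-1).
Proof.
move=> Nabcd Sb /congr_sym Nba.
have -> : c * d^-1 = ((b * a^-1) * (a * c * (b * d)^-1)) ^ b.
  by rewrite /conjg !gnorm.
by apply: (normal_inJ N_normal) => //; apply: (normal_inM N_normal).
Qed.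

End Congruence.
End NormalIn.

(** The outer products run over natural numbers through [inord], so that the indices below and above
    [n] form ordinary intervals. *)
Lemma prod_ord_split (G : groupType) (m : nat) (F : 'I_m.+1 -> G) (n : 'I_m.+1) :
  \prod_(k < m.+1) F k =
  (\prod_(0 <= k < n) F (inord k)) * (F n * \prod_(n.+1 <= k < m.+1) F (inord k)).
Proof.
rewrite (eq_bigr (fun k : 'I_m.+1 => F (inord k))); last first.
  by move=> k _; rewrite inord_val.
rewrite -(big_mkord xpredT (fun k => F (inord k))).
rewrite (@big_cat_nat _ _ _ n) //=; last by rewrite ltnW.
by congr (_ * _); rewrite big_ltn // inord_val.
Qed.

(** * Products of normal subgroups for a group law on a bare type *)

Section Laws.
Variables (U : Type) (op : U -> U -> U) (e : U).
Hypothesis U_group : group_law op e.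
Implicit Types (N P Q : set U) (s : seq (set U)).

Lemma normal_subgroup_one : normal_subgroup op e [set e].
Proof.
have [A e1 e2 _] := U_group; split=> //.
- by move=> u v -> ->; rewrite e1.
- by move=> u v -> <-; rewrite e1.
- by move=> g h u -> gh; rewrite e2.
Qed.

Lemma normal_subgroup_mul P Q : normal_subgroup op e P -> normal_subgroup op e Q ->
  normal_subgroup op e [set op u v | u in P & v in Q].
Proof.
have [opA op1 op1r opV] := U_group.
move=> [P1 PM PV PJ] [Q1 QM QV QJ]; split.
- by exists e => //; exists e => //; rewrite op1.
- move=> _ _ [u Pu [v Qv <-]] [u' Pu' [v' Qv' <-]].
  have [w [wv vw]] := opV v.
  exists (op u (op (op v u') w)); first exact/PM/PJ.
  by exists (op v v'); [apply: QM | rewrite !opA -(opA _ w v) wv op1r].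
- move=> _ z [u Pu [v Qv <-]] uvz.
  have [w [wv vw]] := opV v; have [x [xu ux]] := opV u.
  (* With [w] and [x] the inverses of [v] and [u], the inverse of the product is $wx = (wxv)w$, and
     $wxv$ is a conjugate of [x]. *)
  exists (op (op w x) v); first by apply: PJ => //; apply: PV ux.
  exists w; first exact: QV vw.
  have -> : z = op w x.
    by rewrite -[z]op1 -wv -opA -(op1 (op v z)) -xu -opA (opA u) uvz op1r.
  by rewrite -!opA vw op1r.
- move=> g h _ [u Pu [v Qv <-]] gh.
  (* Only [op g h = e] is given; a right inverse in a group is also a left inverse. *)
  have hg : op h g = e.
    have [g' [g'g gg']] := opV g.
    by rewrite -(_ : g' = h) // -[g']op1r -gh opA g'g op1.
  exists (op (op g u) h); first exact: PJ.
  exists (op (op g v) h); first exact: QJ.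
  by rewrite !opA -(opA _ h g) hg op1r.
Qed.

Lemma set_prod_normal s : (forall N, List.In N s -> normal_subgroup op e N) ->
  normal_subgroup op e (set_prod op e s).
Proof.
elim: s => [|N s IHs] Hs /=; first exact: normal_subgroup_one.
apply: normal_subgroup_mul; first by apply: Hs; left.
by apply: IHs => M Ms; apply: Hs; right.
Qed.

Lemma set_prod_sup s N : (forall M, List.In M s -> normal_subgroup op e M) ->
  List.In N s -> N `<=` set_prod op e s.
Proof.
have [opA op1 op1r opV] := U_group.
elim: s => [|M s IHs] //= Hs.
have nrm : normal_subgroup op e (set_prod op e s).
  by apply: set_prod_normal => P Ps; apply: Hs; right.
case=> [<-|Ns] u Nu; first by exists u => //; exists e => //; case: nrm.
exists e; first by case: (Hs M); [left|].
by exists u; [apply: IHs => // P Ps; apply: Hs; right | rewrite op1].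
Qed.

(** Together with [set_prod_sup], this characterises the product by its set of factors alone. *)
Lemma set_prod_min s N : normal_subgroup op e N ->
  (forall M, List.In M s -> M `<=` N) -> set_prod op e s `<=` N.
Proof.
move=> [N1 NM _ _]; elim: s => [|M s IHs] Hs /=; first by move=> _ ->.
move=> _ [u Mu [v sv <-]]; apply: NM; first by apply: (Hs M); [left|].
by apply: IHs sv => P Ps; apply: Hs; right.
Qed.

End Laws.

Lemma gseqM (A : int -> finGroupType) (a b : gseq A) t : (a * b) t = a t * b t.
Proof. by []. Qed.

Lemma gseqV (A : int -> finGroupType) (a : gseq A) t : a^-1 t = (a t)^-1.
Proof. by []. Qed.

Lemma gseq1 (A : int -> finGroupType) t : (1 : gseq A) t = 1.
Proof. by []. Qed.

Lemma gseq_prod (A : int -> finGroupType) (I : Type) (s : seq I) (P : pred I)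
    (F : I -> gseq A) t :
  (\prod_(i <- s | P i) F i) t = \prod_(i <- s | P i) F i t.
Proof. exact: (big_morph (fun a : gseq A => a t)). Qed.

Lemma In_mem (T : eqType) (x : T) (s : seq T) : List.In x s <-> x \in s.
Proof.
elim: s => [|y s IHs] //=; rewrite inE; split.
  by case=> [->|/IHs ->]; rewrite ?eqxx ?orbT.
by case/predU1P => [->|/IHs]; [left | right].
Qed.

(** * The subgroups $X^t$, $Y^t$ and their products *)

Section System.
Variables (A : int -> finGroupType) (S : group_system A).
Implicit Types (a b x y : gseq A) (t : int).

Lemma group_system_normal : normal_in S S.
Proof.
split=> //; first exact: gs_one.
- exact: gs_mul.
- exact: gs_inv.
- by move=> c a Sc Sa; do 2?apply: gs_mul => //; apply: gs_inv.
Qed.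
Let S_normal := group_system_normal.

(** [Xset], [Yset] and [supported_in] all have this form, each with its own set [D] of times. *)
Lemma vanishing_normal (D : int -> Prop) :
  normal_in S [set a | S a /\ forall s : int, D s -> a s = 1].
Proof.
split=> [a []//|||a [Sa a1]|c a Sc [Sa a1]].
- by split; [apply: gs_one | move=> s _; apply: gseq1].
- move=> a b [Sa a1] [Sb b1]; split; first exact: gs_mul.
  by move=> s Ds; rewrite gseqM a1 // b1 // mulg1.
- split; first exact: gs_inv.
  by move=> s Ds; rewrite gseqV a1 // invg1.
- split; first exact: (normal_inJ S_normal).
  by move=> s Ds; rewrite /conjg !gseqM gseqV a1 // mul1g mulVg.
Qed.

Lemma Xset_normal t : normal_in S (Xset S t).
Proof. exact: vanishing_normal. Qed.

Lemma Yset_normal t : normal_in S (Yset S t).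
Proof. exact: vanishing_normal. Qed.

Lemma Xset_le t n : (t <= n)%R -> Xset S n `<=` Xset S t.
Proof. by move=> tn a [Sa a1]; split=> // s st; apply: a1; lia. Qed.

Lemma Yset_le t n : (t <= n)%R -> Yset S t `<=` Yset S n.
Proof. by move=> tn a [Sa a1]; split=> // s st; apply: a1; lia. Qed.

Lemma XY_normal t n : normal_in S (XY S t n).
Proof.
apply: normal_in_mul => //; first exact: Xset_normal.
by apply: normal_inI => //; [apply: Xset_normal | apply: Yset_normal].
Qed.

(** Dedekind's modular law: $X^t \cap X^{t+1}Y^n = X^{t+1}(X^t \cap Y^n)$, because $X^{t+1}
    \subseteq X^t$. *)
Lemma XY_Xset t n a : Xset S t a ->
  [set x * y | x in Xset S (t + 1)%R & y in Yset S n] a -> XY S t n a.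
Proof.
move=> Xa [x Xx [y Yy xy]]; exists x => //; exists y => //; split=> //.
have -> : y = x^-1 * a by rewrite -xy mulKg.
apply: (normal_inM (Xset_normal t)) => //; apply: (normal_inV (Xset_normal t)).
by apply: Xset_le Xx; lia.
Qed.

Lemma supported_inE t n : supported_in S t n = Xset S t `&` Yset S n.
Proof.
apply/seteqP; split=> a.
  by case=> Sa a1; split; split=> // s st; apply: a1; lia.
case=> [[Sa aX] [_ aY]]; split=> // s.
by rewrite negb_and -!ltNge => /orP[]; [apply: aX | apply: aY].
Qed.

(** * Generators of a basis and finite windows of the infinite product *)

Section Basis.
Variables (l : nat) (B : basis S l).
Hypothesis S_complete : complete S.
Hypothesis S_controllable : controllable S l.
Implicit Types (r : Rtensor B) (k : 'I_l.+1) (i T : int) (N : nat).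

Lemma generator_X k i (g : generator B k i) : Xset S i (sval g).
Proof.
by have := basis_supported (svalP g); rewrite supported_inE => -[].
Qed.

Lemma generator_Y k i (g : generator B k i) : Yset S (i + k%:Z)%R (sval g).
Proof.
by have := basis_supported (svalP g); rewrite supported_inE => -[].
Qed.

Lemma generator_S k i (g : generator B k i) : S (sval g).
Proof. by case: (generator_X g). Qed.

Lemma generator_inj k i (g h : generator B k i) : sval g = sval h -> g = h.
Proof.
case: g h => [g Bg] [h Bh] /= gh; subst h; congr exist; exact: Prop_irrelevance.
Qed.

(** Both generators represent the coset of [sval g], and a transversal has only one representative
    there. *)
Lemma generator_eq_mod k i (g h : generator B k i) :
  XY S i (i + k%:Z - 1)%R (sval g * (sval h)^-1) -> g = h.
Proof.
move=> gh; apply: generator_inj.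
have [sub uniq] := basis_transversal B k i.
have [z [_ zU]] := uniq _ (sub _ (svalP g)).
rewrite -(zU (sval g)); last first.
  split; first exact: svalP.
  by rewrite mulgV; apply: normal_in1 (XY_normal _ _).
by apply: zU; split => //; apply: svalP.
Qed.

Lemma normal_in_prod (P : set (gseq A)) (I : Type) (s : seq I) (p : pred I)
    (F : I -> gseq A) : normal_in S P -> (forall j, p j -> P (F j)) ->
  P (\prod_(j <- s | p j) F j).
Proof.
move=> P_normal PF; apply: (big_ind P) => //.
  exact: normal_in1 P_normal.
exact: normal_inM P_normal.
Qed.

Definition stage r i : gseq A := \prod_(k < l.+1) sval (r k i).

(** A finite window of the infinite product: the starting times run down from [T] to [T - N + 1],
    the later ones on the left. *)
Definition stages r T N : gseq A := \prod_(j < N) stage r (T - j%:Z)%R.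

Lemma stage_X r i : Xset S i (stage r i).
Proof.
by apply: normal_in_prod => [|k _]; [apply: Xset_normal | apply: generator_X].
Qed.

Lemma stage_Y r i : Yset S (i + l%:Z)%R (stage r i).
Proof.
apply: normal_in_prod => [|k _]; first exact: Yset_normal.
by apply: Yset_le (generator_Y _); have := ltn_ord k; lia.
Qed.

Lemma stages_X r T N : Xset S (T + 1 - N%:Z)%R (stages r T N).
Proof.
apply: normal_in_prod => [|j _]; first exact: Xset_normal.
by apply: Xset_le (stage_X _ _); have := ltn_ord j; lia.
Qed.

Lemma stages_Y r T N : Yset S (T + l%:Z)%R (stages r T N).
Proof.
apply: normal_in_prod => [|j _]; first exact: Yset_normal.
by apply: Yset_le (stage_Y _ _); lia.
Qed.

Lemma stagesD r T m N :
  stages r T (m + N) = stages r T m * stages r (T - m%:Z)%R N.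
Proof.
rewrite /stages big_split_ord /=; congr (_ * _).
by apply: eq_bigr => j _; congr stage; lia.
Qed.

Lemma stages_one r T N :
  (forall k i, (T - N%:Z < i)%R -> (i <= T)%R -> r k i = gen_one B k i) ->
  stages r T N = 1.
Proof.
move=> r1; apply: big1 => j _; apply: big1 => k _.
by rewrite r1 //; have := ltn_ord j; lia.
Qed.

Lemma eq_stages r r' T N :
  (forall k i, (T - N%:Z < i)%R -> (i <= T)%R -> r k i = r' k i) ->
  stages r T N = stages r' T N.
Proof.
move=> rr'; apply: eq_bigr => j _; apply: eq_bigr => k _.
by rewrite rr' //; have := ltn_ord j; lia.
Qed.

(** The factors with [k < j], absent from [alpha], belong to generators that end at [t - j + k],
    before [t]. *)
Lemma alpha_stages_diag r t : alpha r t = stages r t l.+1 t.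
Proof.
rewrite /alpha /stages gseq_prod; apply: eq_bigr => j _.
rewrite /stage gseq_prod big_mkcond; apply: eq_bigr => k _.
case: leqP => // kj; have [_ /(_ t) -> //] := generator_Y (r k (t - j%:Z)%R).
by lia.
Qed.

Lemma alpha_stages r T N t : (t <= T)%R -> (T - N%:Z < t - l%:Z)%R ->
  alpha r t = stages r T N t.
Proof.
move=> tT TN; rewrite alpha_stages_diag.
(* Three blocks of starting times: those after [t], those from [t] down to [t - l], and the earlier
   ones. The outer two are trivial at time [t]. *)
have -> : N = (`|T - t| + (l.+1 + (N - `|T - t| - l.+1)))%N by lia.
rewrite !stagesD !gseqM.
have -> : (T - `|T - t|%N%:Z = t)%R by lia.
have [_ /(_ t) ->] := stages_X r T `|T - t|; last by lia.
have [_ /(_ t) ->] := stages_Y r (t - l.+1%:Z)%R (N - `|T - t| - l.+1); last by lia.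
by rewrite mul1g mulg1.
Qed.

(** Completeness is what admits the infinite product: on each finite interval it agrees with a
    finite window. *)
Lemma alpha_S r : S (alpha r).
Proof.
apply: S_complete => m n.
exists (stages r n (`|n - m| + l.+1)); first by case: (stages_X r n (`|n - m| + l.+1)).
by move=> s ms sn; rewrite -alpha_stages //; lia.
Qed.

Lemma alpha_X r t : (forall k i, (i < t)%R -> r k i = gen_one B k i) ->
  Xset S t (alpha r).
Proof.
move=> r1; split=> [|s st]; first exact: alpha_S.
by rewrite alpha_stages_diag stages_one // => k i _ si; apply: r1; lia.
Qed.

Lemma alpha_Y r t : (forall k i, (t < i)%R -> r k i = gen_one B k i) ->
  Yset S (t + l%:Z)%R (alpha r).
Proof.
move=> r1; split=> [|s st]; first exact: alpha_S.
by rewrite alpha_stages_diag stages_one // => k i si _; apply: r1; lia.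
Qed.

Definition restrict (D : int -> bool) r : Rtensor B :=
  fun k i => if D i then r k i else gen_one B k i.

(** The outer factors are the images of [r] restricted to the starting times above and below the
    window; the identity is checked at each time on a larger window. *)
Lemma alpha_decomp r T N : exists x y,
  [/\ Xset S (T + 1)%R x, Yset S (T - N%:Z + l%:Z)%R y &
      alpha r = x * stages r T N * y].
Proof.
exists (alpha (restrict (fun i => T < i)%R r)).
exists (alpha (restrict (fun i => i <= T - N%:Z)%R r)); split.
- by apply: alpha_X => k i iT; rewrite /restrict ifF //; lia.
- by apply: alpha_Y => k i iT; rewrite /restrict ifF //; lia.
apply: functional_extensionality_dep => t; rewrite !gseqM.
pose M1 := `|T - t|%N; pose M2 := (`|T - t| + l.+1)%N.
have E r' : alpha r' t = stages r' (T + M1%:Z)%R M1 t * stages r' T N t *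
    stages r' (T - N%:Z)%R M2 t.
  rewrite (@alpha_stages _ (T + M1%:Z)%R (M1 + (N + M2))%N); try by lia.
  by rewrite !stagesD !gseqM mulgA addrK.
rewrite !E; congr (_ * _ * _).
- rewrite (@stages_one _ T); last by move=> k i _ ?; rewrite /restrict ifF //; lia.
  rewrite (@stages_one _ (T - N%:Z)%R); last first.
    by move=> k i _ ?; rewrite /restrict ifF //; lia.
  rewrite !gseq1 !mulg1.
  by congr (_ t); apply: eq_stages => k i ? _; rewrite /restrict ifT //; lia.
- rewrite (@stages_one _ (T + M1%:Z)%R); last first.
    by move=> k i ? _; rewrite /restrict ifF //; lia.
  rewrite (@stages_one _ T); last by move=> k i ? _; rewrite /restrict ifF //; lia.
  rewrite !gseq1 !mul1g.
  by congr (_ t); apply: eq_stages => k i _ ?; rewrite /restrict ifT //; lia.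
Qed.

(** * Uniqueness of the expansion in generators *)

Lemma congr_prod (P : set (gseq A)) (I : Type) (s : seq I) (p : pred I)
    (F F' : I -> gseq A) : normal_in S P -> (forall j, p j -> S (F j)) ->
  (forall j, p j -> P (F j * (F' j)^-1)) ->
  P ((\prod_(j <- s | p j) F j) * (\prod_(j <- s | p j) F' j)^-1).
Proof.
move=> P_normal SF PF; elim: s => [|j s IHs].
  by rewrite !big_nil; apply: congr_refl P_normal _.
rewrite !big_cons; case: ifP => // pj.
by apply: (congr_mul S_normal P_normal); [apply: SF | apply: PF |].
Qed.

Lemma alpha_inj_mod r r' T : Yset S T (alpha r * (alpha r')^-1) ->
  forall k i, (T < i + k%:Z)%R -> r k i = r' k i.
Proof.
move=> Yrr'.
(* Descending induction on the length [k]; the base case is vacuous because [k] is at most [l]. *)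
suff: forall (n : nat) k i, (l < k + n)%N -> (T < i + k%:Z)%R -> r k i = r' k i.
  by move=> H k i; apply: (H l.+1); lia.
elim=> [|n IHn] k i kn Tik; first by have := ltn_ord k; lia.
(* The time just before the span of [r k i] ends. Modulo [M], everything that starts after [i] or
   ends by [t] is trivial. *)
set t := (i + k%:Z - 1)%R.
pose M := [set x * y | x in Xset S (i + 1)%R & y in Yset S t].
have M_normal : normal_in S M.
  by apply: normal_in_mul => //; [apply: Xset_normal | apply: Yset_normal].
have XM x : Xset S (i + 1)%R x -> M x.
  move=> Xx; exists x => //; exists 1; rewrite ?mulg1 //.
  exact: normal_in1 (Yset_normal _).
have YM u y : (u <= t)%R -> Yset S u y -> M y.
  move=> ut /(Yset_le ut) Yy; exists 1; last by exists y; rewrite ?mul1g.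
  exact: normal_in1 (Xset_normal _).
have SX r1 j : S (stage r1 j) by case: (stage_X r1 j).
have SY r1 j N : S (stages r1 j N) by case: (stages_Y r1 j N).
(* A window of [l + 1] starting times suffices: whatever starts before it ends by [i - 1], hence by
   [t]. *)
have [x [y [Xx Yy rxy]]] := alpha_decomp r i l.+1.
have [x' [y' [Xx' Yy' rxy']]] := alpha_decomp r' i l.+1.
have {Yrr'} : M (alpha r * (alpha r')^-1) by apply: YM Yrr'; lia.
rewrite rxy rxy' => /(congr_cancelr S_normal M_normal) Mrr'.
have {Mrr'} : M (x * stages r i l.+1 * (x' * stages r' i l.+1)^-1).
  apply: Mrr'; first by apply: gs_mul => //; case: Xx'.
  by apply: (congr_mem M_normal); apply: (YM (i - l.+1%:Z + l%:Z)%R) => //; lia.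
move=> /(congr_cancell M_normal) Mrr'.
have {Mrr'} : M (stages r i (1 + l) * (stages r' i (1 + l))^-1).
  by apply: Mrr'; [case: Xx' | apply: (congr_mem M_normal); apply: XM].
rewrite !stagesD => /(congr_cancelr S_normal M_normal) Mrr'.
have {Mrr'} : M (stage r i * (stage r' i)^-1).
  rewrite [stages r i 1]big_ord1 [stages r' i 1]big_ord1 subr0 in Mrr'.
  apply: Mrr' => //; apply: congr_prod => // j _; apply: congr_prod => //.
    by move=> m _; apply: generator_S.
  (* A generator that starts before [i] and ends after [t] is longer than [k], so induction applies
     to it; one that ends by [t] lies in [M]. *)
  move=> m _; set i' := (_ - _)%R; have i'i : (i' < i)%R by rewrite /i'; lia.
  case: (leP (i' + m%:Z)%R t) => [mt|tm]; last first.
    by rewrite (IHn m); [apply: congr_refl M_normal _| |]; lia.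
  by apply: (congr_mem M_normal); apply: YM (generator_Y _).
(* Among the generators starting at [i], the shorter ones lie in [M] and the longer ones agree by
   induction. *)
rewrite /stage !(prod_ord_split _ k) => /(congr_cancell M_normal) Mrr'.
have Yprod r1 : M (\prod_(0 <= m < k) sval (r1 (inord m) i)).
  rewrite big_nat; apply: normal_in_prod => // m mk.
  apply: YM (generator_Y _); rewrite inordK; first by lia.
  by have := ltn_ord k; lia.
have /Mrr' {Mrr'} := normal_in_sub M_normal (Yprod r').
have /[swap] /[apply] := congr_mem M_normal (Yprod r) (Yprod r').
move=> /(congr_cancelr S_normal M_normal) Mrr'.
have {Mrr'} Mrr' : M (sval (r k i) * (sval (r' k i))^-1).
  apply: Mrr'; first exact: generator_S.
  rewrite big_nat [X in _ * X^-1]big_nat; apply: congr_prod => // m.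
    by move=> _; apply: generator_S.
  move=> mk; rewrite (IHn (inord m)); first exact: congr_refl M_normal _.
    by rewrite inordK; lia.
  by rewrite inordK; lia.
apply/generator_eq_mod/XY_Xset => //.
by apply: congr_mem (generator_X _) (generator_X _); apply: Xset_normal.
Qed.

Lemma alpha_inj r r' : alpha r = alpha r' -> r = r'.
Proof.
move=> rr'; apply: functional_extensionality_dep => k.
apply: functional_extensionality_dep => i.
apply: (@alpha_inj_mod _ _ (i + k%:Z - 1)%R); last by lia.
by rewrite rr' mulgV; apply: normal_in1 (Yset_normal _).
Qed.

Lemma alpha_one : alpha (@r_one _ _ _ B) = 1.
Proof.
apply: functional_extensionality_dep => t.
by rewrite alpha_stages_diag stages_one.
Qed.

(** * Existence of the expansion in generators *)

Lemma XY_decomp t (n : nat) x : (n <= l.+1)%N -> XY S t (t + n%:Z - 1)%R x ->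
  exists h : 'I_l.+1 -> gseq A,
    [/\ forall k, B k t (h k), forall k, (n <= k)%N -> h k = 1 &
        Xset S (t + 1)%R (x * (\prod_(k < l.+1) h k)^-1)].
Proof.
elim: n x => [|n IHn] x nl.
  case=> u Xu [v [[_ vX] [_ vY]] <-].
  exists (fun=> 1); split=> // [k|]; first exact: basis_one.
  have -> : v = 1.
    apply: functional_extensionality_dep => s.
    by have [st|st] := ltP s t; [apply: vX | apply: vY; lia].
  by rewrite big1 // mulg1 invg1 mulg1.
have -> : (t + n.+1%:Z - 1 = t + n%:Z)%R by lia.
move=> XYx; pose k0 : 'I_l.+1 := Ordinal nl.
(* The generator of length [n] is split off first, on the right; the shorter ones come from
   expanding $xg^{-1}$. *)
have [_ /(_ x XYx)[g [[Bg XYg] _]]] := basis_transversal B k0 t.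
have [h [Bh h1 Xh]] := IHn _ (ltnW nl) XYg.
exists (fun k => if k == k0 then g else h k); split.
- by move=> k; case: eqP => [->|].
- move=> k nk; rewrite ifF; first by apply: h1; lia.
  by apply/eqP => kk0; rewrite kk0 ltnn in nk.
have tail1 (h' : 'I_l.+1 -> gseq A) : (forall k, (n < k)%N -> h' k = 1) ->
    \prod_(n.+1 <= k < l.+1) h' (inord k) = 1.
  by move=> h'1; rewrite big_nat big1 // => k nk; apply: h'1; rewrite inordK; lia.
have tailh := tail1 h (fun k nk => h1 k (ltnW nk)).
have tailg : \prod_(n.+1 <= k < l.+1) (if inord k == k0 then g else h (inord k)) = 1.
  apply: (tail1 (fun k => if k == k0 then g else h k)) => k nk.
  rewrite ifF; first by apply: h1; apply: ltnW.
  by apply/eqP => kk0; rewrite kk0 ltnn in nk.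
move: Xh; rewrite !(prod_ord_split _ k0) eqxx h1 //= tailh tailg.
rewrite !mulg1 invgM !mulgA; congr (Xset _ _ (_ * _^-1)).
rewrite big_nat [RHS]big_nat; apply: eq_bigr => k kn.
by rewrite ifF //; apply/eqP => /(congr1 val) /=; rewrite inordK; lia.
Qed.

(** Controllability gives $X^t = X^{t+1}(X^t \cap Y^{t+\ell})$: an element [c] that follows [x] up
    to time [t] and is trivial from [t + 1 + l] on is the second factor. *)
Lemma Xset_decomp t x : Xset S t x ->
  exists g : forall k, generator B k t,
    Xset S (t + 1)%R (x * (\prod_(k < l.+1) sval (g k))^-1).
Proof.
move=> [Sx x1]; have [c [Sc cx c1]] := S_controllable.2 (t + 1)%R _ _ Sx (gs_one S).
have [||h [Bh _ Xh]] := @XY_decomp t l.+1 x _ _ => //; last first.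
  by exists (fun k => exist _ (h k) (Bh k)).
have -> : (t + l.+1%:Z - 1 = t + l%:Z)%R by lia.
exists (x * c^-1); last exists c; last by rewrite mulgVK.
  split; first by apply: gs_mul => //; apply: gs_inv.
  by move=> s st; rewrite gseqM gseqV cx // mulgV.
by split; split=> // s st; [rewrite cx ?x1 //; lia | rewrite c1 //; lia].
Qed.

(** Stages are stripped off on the right one starting time after another. The remainder after [n]
    steps lies in $X^{t+n}$, so each component is settled after finitely many steps. *)
Lemma alpha_surj_X t a : Xset S t a ->
  exists2 r : Rtensor B, (forall k i, (i < t)%R -> r k i = gen_one B k i) & alpha r = a.
Proof.
move=> Xa.
have step i x : {g : forall k, generator B k i | Xset S i x ->
    Xset S (i + 1)%R (x * (\prod_(k < l.+1) sval (g k))^-1)}.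
  (* Trivial generators serve as default outside [Xset S i]; the remainders [xs] never leave the
     sets where a true expansion exists. *)
  apply: cid; have [/Xset_decomp[g Xg]|nX] := pselect (Xset S i x); first by exists g.
  by exists (fun k => gen_one B k i).
pose w i x := \prod_(k < l.+1) sval (sval (step i x) k).
pose xs := fix xs (n : nat) : gseq A :=
  if n is m.+1 then xs m * (w (t + m%:Z)%R (xs m))^-1 else a.
have Xxs n : Xset S (t + n%:Z)%R (xs n).
  elim: n => [|n IHn]; first by rewrite addr0.
  have -> : (t + n.+1%:Z = t + n%:Z + 1)%R by lia.
  exact: (svalP (step _ _)) IHn.
pose r : Rtensor B := fun k i =>
  if (t <= i)%R then sval (step i (xs `|i - t|%N)) k else gen_one B k i.
have r1 k i : (i < t)%R -> r k i = gen_one B k i by rewrite /r; case: leP.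
have stage_r n : stage r (t + n%:Z)%R = w (t + n%:Z)%R (xs n).
  apply: eq_bigr => k _; rewrite /r ifT; last by lia.
  by have -> : `|(t + n%:Z - t)%R|%N = n by lia.
have a_stages n : a = xs n * stages r (t + n%:Z - 1)%R n.
  elim: n => [|n IHn]; first by rewrite /stages big_ord0 mulg1.
  have -> : (t + n.+1%:Z - 1 = t + n%:Z)%R by lia.
  rewrite -[n.+1]/(1 + n)%N stagesD [stages _ _ 1]big_ord1 subr0 stage_r /=.
  by rewrite mulgA mulgVK.
exists r => //; apply: functional_extensionality_dep => s.
pose n := `|s - t|.+1; pose m := (`|s - t| + l.+1)%N.
rewrite (@alpha_stages _ (t + n%:Z - 1)%R (n + m)%N); try by lia.
rewrite stagesD (@stages_one _ _ m) ?mulg1; last by move=> k i _ ?; apply: r1; lia.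
rewrite [in RHS](a_stages n) gseqM; have [_ ->] := Xxs n; last by lia.
by rewrite mul1g.
Qed.

(* [rr T] decodes an element of [Xset T] that agrees with [a] from [T + l] on;
   by [alpha_inj_mod] its generators ending at [T + l] or later do not depend
   on [T]. *)
Lemma alpha_surj a : S a -> exists r : Rtensor B, alpha r = a.
Proof.
move=> Sa.
have dec T : {r : Rtensor B | forall s : int, (T + l%:Z <= s)%R -> alpha r s = a s}.
  apply: cid; have [c [Sc c1 ca]] := S_controllable.2 T _ _ (gs_one S) Sa.
  by have [|r _ rc] := @alpha_surj_X T c; [split | exists r => s; rewrite rc; apply: ca].
pose rr T := sval (dec T); have rrE T s : (T + l%:Z <= s)%R -> alpha (rr T) s = a s.
  exact: (svalP (dec T)).
have rr_eq T T' k i : (T <= T')%R -> (T' <= i + k%:Z - l%:Z)%R -> rr T k i = rr T' k i.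
  move=> TT' T'i; apply: (@alpha_inj_mod _ _ (T' + l%:Z - 1)%R); last by lia.
  split; first by apply: gs_mul; [|apply: gs_inv]; apply: alpha_S.
  by move=> s Ts; rewrite gseqM gseqV !rrE ?mulgV //; lia.
(* The base [i - l] is within the stable range for every length [k], since [i + k] is at least
   [(i - l) + l]. *)
exists (fun k i => rr (i - l%:Z)%R k i); apply: functional_extensionality_dep => t.
(* Time [t] involves only starting times from [t - l] on, so one tensor, based at [t - 2l], supplies
   all the generators concerned. *)
rewrite -(rrE (t - l%:Z - l%:Z)%R); last by lia.
rewrite !alpha_stages_diag; congr (_ t); apply: eq_stages => k i ti _.
by apply/esym/rr_eq; lia.
Qed.

Lemma alpha_supported r (k : 'I_l.+1) t :
  supported_in S t (t + k%:Z)%R (alpha r) <->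
  forall m i, ~ lower_triangle (k, t) (m, i) -> r m i = gen_one B m i.
Proof.
split=> [|r1].
  rewrite supported_inE => -[Xr Yr] m i.
  have [it _|ti] := ltP i t.
    by have [r' r'1 /alpha_inj <-] := alpha_surj_X Xr; apply: r'1.
  (* Starting at [t] or later but outside the triangle means ending after [t + k], where comparison
     with the trivial tensor applies. *)
  move=> ntri; apply: (@alpha_inj_mod r (@r_one _ _ _ B) (t + k%:Z)%R).
    by rewrite alpha_one invg1 mulg1.
  by rewrite ltNge; apply/negP => mik; apply: ntri.
split=> [|s]; first exact: alpha_S.
rewrite negb_and -!ltNge => Ds; rewrite /alpha big1 // => j _; rewrite big1 // => m jm.
(* As [j <= m], the span of this generator contains [s]; a span given by the triangle would force
   [s] into $[t, t+k]$. *)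
have [[/= tj mk]|/r1 -> //] := pselect (lower_triangle (k, t) (m, (s - j%:Z)%R)).
by case/orP: Ds; lia.
Qed.

(** * The generator group on label tensors and its lower elementary groups *)

Section Labels.
Variables (G : 'I_l.+1 -> int -> Type).
Variable lab : forall k t, generator B k t -> G k t.
Hypothesis lab_bij : forall k t, bijective (@lab k t).
Implicit Types (u v : Utensor G).

Lemma beta_inj : injective (beta lab).
Proof.
move=> r r' rr'; apply: functional_extensionality_dep => k.
apply: functional_extensionality_dep => t; apply: (bij_inj (@lab_bij k t)).
by have := congr1 (fun u : Utensor G => u k t) rr'.
Qed.

Lemma betaK : cancel (beta lab) (beta_inv lab).
Proof. by move=> r; apply: pinvKV; rewrite ?in_setT //; move=> ? ? _ _ /beta_inj. Qed.

Lemma beta_invK : cancel (beta_inv lab) (beta lab).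
Proof.
move=> u.
have H k t : {g | lab g = u k t}.
  by apply: cid; have [g _ gK] := @lab_bij k t; exists (g (u k t)).
have <- : beta lab (fun k t => sval (H k t)) = u.
  apply: functional_extensionality_dep => k.
  by apply: functional_extensionality_dep => t; apply: (svalP (H k t)).
by rewrite betaK.
Qed.

Lemma alpha_invK a : S a -> alpha (alpha_inv B a) = a.
Proof.
by move=> /alpha_surj[r <-]; apply: pinvK; rewrite inE; exists r.
Qed.

(** The inverse of the isomorphism $\beta\circ\alpha^{-1}$; the group laws and normality are pulled
    back along it. *)
Definition decode u : gseq A := alpha (beta_inv lab u).

Lemma decode_S u : S (decode u).
Proof. exact: alpha_S. Qed.

Lemma decode_inj : injective decode.
Proof. by move=> u v /alpha_inj /(can_inj beta_invK). Qed.

Lemma decode_surj a : S a -> exists u, decode u = a.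
Proof.
by move=> /alpha_surj[r ra]; exists (beta lab r); rewrite /decode betaK.
Qed.

Lemma decode_mul u v : decode (u_mul lab u v) = decode u * decode v.
Proof.
by rewrite /decode betaK alpha_invK //; apply: gs_mul; apply: decode_S.
Qed.

Lemma decode_one : decode (u_one lab) = 1.
Proof. by rewrite /decode betaK alpha_one. Qed.

Lemma u_mul_group : group_law (u_mul lab) (u_one lab).
Proof.
split.
- by move=> u v w; apply: decode_inj; rewrite !decode_mul mulgA.
- by move=> u; apply: decode_inj; rewrite decode_mul decode_one mul1g.
- by move=> u; apply: decode_inj; rewrite decode_mul decode_one mulg1.
- move=> u; have [v vu] := decode_surj (gs_inv (decode_S u)).
  by exists v; split; apply: decode_inj; rewrite decode_mul decode_one vu ?mulgV ?mulVg.
Qed.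

Lemma lower_elementaryE (p : 'I_l.+1 * int) u :
  lower_elementary lab p u <-> supported_in S p.2 (p.2 + p.1%:Z)%R (decode u).
Proof.
case: p => k t /=; rewrite alpha_supported /lower_elementary /=.
have uE m i : u m i = lab (beta_inv lab u m i).
  by have := congr1 (fun v : Utensor G => v m i) (beta_invK u).
split=> u1 m i /u1; rewrite uE; last by move=> ->.
exact: (bij_inj (@lab_bij m i)).
Qed.

Lemma lower_elementary_normal (p : 'I_l.+1 * int) :
  normal_subgroup (u_mul lab) (u_one lab) (lower_elementary lab p).
Proof.
have [_ N1 NM NV NJ] : normal_in S (supported_in S p.2 (p.2 + p.1%:Z)%R).
  exact: vanishing_normal.
split.
- by apply/lower_elementaryE; rewrite decode_one.
- by move=> u v /lower_elementaryE Nu /lower_elementaryE Nv; apply/lower_elementaryE;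
    rewrite decode_mul; apply: NM.
- move=> u v /lower_elementaryE Nu /(congr1 decode).
  rewrite decode_mul decode_one => /mulg1_eq uv.
  by apply/lower_elementaryE; rewrite -uv; apply: NV.
- move=> g h u /lower_elementaryE Nu /(congr1 decode).
  rewrite decode_mul decode_one => /mulg1_eq gh.
  apply/lower_elementaryE; rewrite !decode_mul -gh.
  (* The product is rewritten as the conjugate of [decode u] by the inverse of [decode g]. *)
  rewrite -[X in X * _ * _]invgK -mulgA; apply: NJ => //.
  by apply: gs_inv; apply: decode_S.
Qed.

Lemma lower_elementary_le (p q : 'I_l.+1 * int) :
  lower_triangle p `<=` lower_triangle q ->
  lower_elementary lab p `<=` lower_elementary lab q.
Proof. by move=> pq u pu k t ntri; apply: pu => /pq. Qed.

Lemma elementary_prod_normal (s : seq ('I_l.+1 * int)) :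
  normal_subgroup (u_mul lab) (u_one lab) (elementary_prod lab s).
Proof.
apply: set_prod_normal; first exact: u_mul_group.
by move=> N /List.in_map_iff[p [<- _]]; apply: lower_elementary_normal.
Qed.

(** A smaller triangle has a smaller elementary group, so each factor on the left lies in a factor
    on the right. This yields both the inclusions of the chain and independence of the order. *)
Lemma elementary_prod_le (s s' : seq ('I_l.+1 * int)) :
  (forall p, p \in s -> exists2 q, q \in s' & lower_triangle p `<=` lower_triangle q) ->
  elementary_prod lab s `<=` elementary_prod lab s'.
Proof.
move=> ss'; apply: set_prod_min; first exact: elementary_prod_normal.
move=> N /List.in_map_iff[p [<- /In_mem /ss'[q qs' pq]]].
apply: subset_trans (lower_elementary_le pq) _.
apply: set_prod_sup; first exact: u_mul_group.
  by move=> M /List.in_map_iff[p' [<- _]]; apply: lower_elementary_normal.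
by apply/List.in_map_iff; exists q; split=> //; apply/In_mem.
Qed.

Lemma elementary_prod_perm (s s' : seq ('I_l.+1 * int)) :
  perm_eq s s' -> elementary_prod lab s = elementary_prod lab s'.
Proof.
move=> ss'; apply/seteqP; split; apply: elementary_prod_le => p ps; exists p => //.
  by rewrite -(perm_mem ss').
by rewrite (perm_mem ss').
Qed.

End Labels.
End Basis.
End System.

(** * Maximal lower triangles and the chain *)

Lemma lower_triangle_self l (p : 'I_l.+1 * int) : lower_triangle p p.
Proof. by []. Qed.

(** Passing to a strictly longer triangle inside [E] must stop, since lengths are bounded by [l]. A
    containing triangle that is not longer is the same triangle. *)
Lemma maximal_triangle_above l (E : set ('I_l.+1 * int)) p :
  lower_triangle p `<=` E ->
  exists2 q, maximal_triangle E q & lower_triangle p `<=` lower_triangle q.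
Proof.
have [n] := ubnP (l - p.1); elim: n p => // n IHn p pn pE.
have [[q qE [pq ltpq]]|max] := pselect
  (exists2 q, lower_triangle q `<=` E &
     lower_triangle p `<=` lower_triangle q /\ (p.1 < q.1)%N).
  have [|//|q' q'max qq'] := IHn q; first by have := ltn_ord q.1; lia.
  by exists q' => //; apply: subset_trans qq'.
exists p => //; split=> // q qE pq.
have [qp1 qp2] := pq _ (lower_triangle_self p).
have pq1 : (q.1 <= p.1)%N.
  by rewrite leqNgt; apply/negP => ltpq; apply: max; exists q.
suff -> : p = q by [].
rewrite [p]surjective_pairing [q]surjective_pairing; apply/pair_equal_spec.
by split; [apply: val_inj => /=|]; lia.
Qed.

Theorem theorem56 (A : int -> finGroupType) (S : group_system A) (l : nat)
    (S_controllable : controllable S l) (S_complete : complete S)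
    (B : basis S l)
    (G : 'I_l.+1 -> int -> Type)
    (lab : forall (k : 'I_l.+1) (t : int), generator B k t -> G k t)
    (lab_bij : forall (k : 'I_l.+1) (t : int), bijective (lab k t))
    (f : nat -> 'I_l.+1 * int) (f_normal : normal_filling f) :
  group_law (u_mul lab) (u_one lab) /\
  exists L : nat -> set (Utensor G),
    normal_chain (u_mul lab) (u_one lab) L /\
    forall (tau : nat) (s : seq ('I_l.+1 * int)),
      (0 < tau)%N -> perm_eq s (maximal_triangles f tau) ->
      L tau = elementary_prod lab s.
Proof.
split; first exact: u_mul_group.
exists (fun tau => elementary_prod lab (maximal_triangles f tau)); split; last first.
  by move=> tau s _ /elementary_prod_perm ->.
have nrm tau := elementary_prod_normal S_complete S_controllable lab_bij
  (maximal_triangles f tau).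
split=> [|tau _|//]; first by move=> _ ->; case: (nrm 1%N).
apply: elementary_prod_le => // p.
rewrite mem_filter => /andP[/asboolP[pE _] _].
have [|q qmax pq] := @maximal_triangle_above l [set` first_pairs f tau.+1] p.
  apply: subset_trans pE _ => q /=; rewrite /first_pairs !mkseqS.
  by rewrite mem_rcons inE => ->; rewrite orbT.
exists q => //; rewrite mem_filter; apply/andP; split; first exact/asboolP.
(* The index [q] is itself among the first pairs, being a vertex of its own triangle. *)
exact: qmax.1 (lower_triangle_self q).
Qed.
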